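(* Let $f(X)=a_{0}+a_{1}X+\cdots +a_{n}X^{n}\in \mathbb{Z}[X]$, $a_{0}a_{n}\neq 0$. Suppose there exist two distinct prime numbers $p,q$ and two distinct indices $j_{1},j_{2}\in\{0,\dots ,n\}$ such that $j_{1}<\min(j_{2},n-j_{2})$ and (i) $\nu _{p}(a_{i})=0$ for all $0\le i\leq j_{1}$, $\frac{\nu _{p}(a_{i})}{i-j_{1}}>\frac{\nu _{p}(a_{n})}{n-j_{1}}$ for $j_{1}<i<n$, and $\nu _{p}(a_{n})>0$; (ii) $\frac{\nu _{q}(a_{0})}{n}>\frac{\nu _{q}(a_{j_{2}})}{n-j_{2}}$; $\nu _{q}(a_{i}) > \frac{j_{2}-i}{j_{2}}\, \nu _{q}(a_{0})+\frac{i}{j_{2}}\, \nu _{q}(a_{j_{2}})$ for $0<i<j_{2}$; $\nu _{q}(a_{j_{2}})>0$; $\frac{\nu _{q}(a_{i})}{n-i} > \frac{\nu _{q}(a_{j_{2}})}{n-j_{2}}$ for $j_{2}<i<n$; and $\nu _{q}(a_{n}) = 0$; (iii) $\gcd(\nu _{p}(a_{n}),n-j_{1})=\gcd(\nu _{q}(a_{0})-\nu _{q}(a_{j_{2}}),j_{2})=\gcd(\nu _{q}(a_{j_{2}}),n-j_{2})=1$. Then $f$ is irreducible over $\mathbb{Q}$.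
   Context: For a prime $p$ and a nonzero integer $m$, $\nu_p(m)$ is the largest integer $i$ such that $p^i\mid m$; by convention $\nu_p(0)=\infty$ (so lower bounds on $\nu_p(a_i)$ hold automatically when $a_i=0$). *)

(* Defs.v *)
From mathcomp Require Import all_boot all_order all_algebra.
From mathcomp Require Import constructive_ereal.

Set Implicit Arguments.
Unset Strict Implicit.
Unset Printing Implicit Defensive.

Import Order.TTheory GRing.Theory Num.Theory.

Local Open Scope ring_scope.

(* For a != 0 only: since logn p 0 = 0, this has the junk value 0 at a = 0. *)
Definition valz (p : nat) (a : int) : nat := logn p `|a|%N.

Definition nu (p : nat) (a : int) : \bar rat :=
  if a == 0 then +oo%E else ((valz p a)%:R)%:E.

(* Main.v *)
(* For each line, the segment of the Newton polygon of a product on that line has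
   as end abscissas the sums of those of the factors, and a primitive segment
   (coprime height and width) goes whole to one factor.  At [p] the segment from
   [j1] to [n] is primitive, so one factor of [f] has degree at most [j1].  At
   [q] the polygon consists of two primitive segments, of widths [j2] and
   [n - j2], so every nonconstant factor has degree at least
   [min(j2, n - j2) > j1]. *)
Require Import Defs.
From mathcomp Require Import all_boot all_order all_algebra.
From mathcomp Require Import constructive_ereal zify.

Import Order.TTheory GRing.Theory Num.Theory.

Local Open Scope ring_scope.

Set Implicit Arguments.
Unset Strict Implicit.
Unset Printing Implicit Defensive.

(** * Valuations of integers *)

Lemma dvdz_exp_valz (p e : nat) (x : int) :
  prime p -> x != 0 -> ((p ^ e)%N%:Z %| x)%Z = (e <= valz p x)%N.
Proof.
by move=> p_pr x0; rewrite dvdzE /= pfactor_dvdn // absz_gt0.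
Qed.

Lemma valzM (p : nat) (x y : int) :
  x != 0 -> y != 0 -> valz p (x * y) = (valz p x + valz p y)%N.
Proof. by move=> x0 y0; rewrite /valz abszM lognM ?absz_gt0. Qed.

Lemma valzN (p : nat) (x : int) : valz p (- x) = valz p x.
Proof. by rewrite /valz abszN. Qed.

(** Zero is treated apart because [valz] takes the value 0 there; the two conditions say that
    [p ^ e] divides both terms. *)
Lemma valzD_ge (p e : nat) (x y : int) : prime p -> x + y != 0 ->
  (x == 0) || (e <= valz p x)%N -> (y == 0) || (e <= valz p y)%N ->
  (e <= valz p (x + y))%N.
Proof.
move=> p_pr xy0 hx hy.
have dvd z : (z == 0) || (e <= valz p z)%N -> ((p ^ e)%N%:Z %| z)%Z.
  have [-> _|z0 /=] := eqVneq z 0; first exact: dvdz0.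
  by rewrite dvdz_exp_valz.
by rewrite -dvdz_exp_valz //; apply: rpredD; apply: dvd.
Qed.

(** * Points relative to a line *)

(* The point [(k, nu_p x)] lies on or above the line [c X + b Y = m]. *)
Definition above (p b : nat) (c m : int) (k : nat) (x : int) : bool :=
  (x == 0) || (m <= c * k%:Z + b%:Z * (valz p x)%:Z).

(** All quantities are integers, so strictly above means above the line for [m + 1]. Zero is above
    every line and hence on none. *)
Definition on_line (p b : nat) (c m : int) (k : nat) (x : int) : bool :=
  above p b c m k x && ~~ above p b c (m + 1) k x.

Lemma above_on_line (p b : nat) (c m : int) (k : nat) (x : int) :
  x != 0 -> c * k%:Z + b%:Z * (valz p x)%:Z = m -> on_line p b c m k x.
Proof. by move=> /negPf x0 <-; rewrite /on_line /above x0 /=; lia. Qed.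

Lemma on_lineP (p b : nat) (c m : int) (k : nat) (x : int) :
  on_line p b c m k x -> x != 0 /\ c * k%:Z + b%:Z * (valz p x)%:Z = m.
Proof. by rewrite /on_line /above; case: eqP => //= _; lia. Qed.

Lemma aboveW (p b : nat) (c m m' : int) (k : nat) (x : int) :
  m' <= m -> above p b c m k x -> above p b c m' k x.
Proof. by rewrite /above; case: eqP => //= _; lia. Qed.

Section Line.
Variables (p b : nat) (c : int).
Hypothesis p_pr : prime p.

Lemma aboveN (m : int) (k : nat) (x : int) :
  above p b c m k (- x) = above p b c m k x.
Proof. by rewrite /above oppr_eq0 valzN. Qed.

Lemma aboveD (m : int) (k : nat) (x y : int) :
  above p b c m k x -> above p b c m k y -> above p b c m k (x + y).
Proof.
rewrite /above; have [//|xy0 /=] := eqVneq (x + y) 0.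
(* The exponent is the smaller valuation; a zero term borrows that of the other one. *)
have := @valzD_ge p (minn (if x == 0 then valz p y else valz p x)
  (if y == 0 then valz p x else valz p y)) x y p_pr xy0.
have [x0|_] := eqVneq x 0; have [y0|_] := eqVneq y 0 => /=.
- by move: xy0; rewrite x0 y0 addr0 eqxx.
- by rewrite minnn leqnn => /(_ isT isT) ? _ ?; nia.
- by rewrite minnn leqnn => /(_ isT isT) ? ? _; nia.
- rewrite geq_minl geq_minr => /(_ isT isT); rewrite geq_min => /orP[] ? ? ?; nia.
Qed.

Lemma above_sum (I : Type) (r : seq I) (P : pred I) (F : I -> int)
    (m : int) (k : nat) :
  (forall i, P i -> above p b c m k (F i)) ->
  above p b c m k (\sum_(i <- r | P i) F i).
Proof.
move=> abF; apply: (big_ind (above p b c m k)) => // x y.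
exact: aboveD.
Qed.

Lemma aboveM (m m' : int) (k k' : nat) (x y : int) :
  above p b c m k x -> above p b c m' k' y ->
  above p b c (m + m') (k + k') (x * y).
Proof.
rewrite /above mulf_eq0; have [//|x0] := eqVneq x 0; have [//|y0] := eqVneq y 0.
by rewrite /= valzM //; lia.
Qed.

Lemma on_lineM (m m' : int) (k k' : nat) (x y : int) :
  on_line p b c m k x -> on_line p b c m' k' y ->
  on_line p b c (m + m') (k + k') (x * y).
Proof.
move=> /on_lineP[x0 ex] /on_lineP[y0 ey]; apply: above_on_line.
  by rewrite mulf_neq0.
by rewrite valzM //; lia.
Qed.

(** If [x + y] were strictly above the line, so would be [x = (x + y) - y]. *)
Lemma on_lineD (m : int) (k : nat) (x y : int) :
  on_line p b c m k x -> above p b c (m + 1) k y -> on_line p b c m k (x + y).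
Proof.
move=> /andP[abx nabx] aby; apply/andP; split.
  by apply: aboveD => //; apply: aboveW aby; lia.
apply: contra nabx => abxy.
by rewrite -(addrK y x); apply: aboveD; rewrite ?aboveN.
Qed.

(** * Supporting lines: existence and uniqueness *)

(* [c X + b Y = m] supports the Newton polygon of [f] with respect to [p], and
   meets it in the segment with end abscissas [l] and [u]. *)
Record supporting (f : {poly int}) (m : int) (l u : nat) : Prop := {
  supp_above : forall i, above p b c m i f`_i;
  supp_l : on_line p b c m l f`_l;
  supp_u : on_line p b c m u f`_u;
  supp_left : forall i, (i < l)%N -> above p b c (m + 1) i f`_i;
  supp_right : forall i, (u < i)%N -> above p b c (m + 1) i f`_i }.

(** [m] is the least value of [W] over the nonzero coefficients; [l] and [u] are the first and last
    indices attaining it. *)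
Lemma supporting_exists (f : {poly int}) :
  f != 0 -> exists m l u, supporting f m l u.
Proof.
move=> f0; pose W (i : 'I_(size f)) := c * i%:Z + b%:Z * (valz p f`_i)%:Z.
have sz0 : (0 < size f)%N by rewrite size_poly_gt0.
have lead_lt : ((size f).-1 < size f)%N by rewrite prednK.
have lead0 : f`_(Ordinal lead_lt) != 0 by rewrite -lead_coefE lead_coef_eq0.
have [i0 fi0 i0_min] := arg_minP W (lead0 : [pred i : 'I_(size f) | f`_i != 0] _).
have ab i : above p b c (W i0) i f`_i.
  rewrite /above; have [//|fi /=] := eqVneq f`_i 0.
  have lti : (i < size f)%N.
    by rewrite ltnNge; apply: contra fi => szi; rewrite nth_default.
  exact: (i0_min (Ordinal lti)).
have exP : exists i, ~~ above p b c (W i0 + 1) i f`_i.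
  by exists i0; have /andP[] := @above_on_line p b c (W i0) i0 _ fi0 erefl.
have ubP i : ~~ above p b c (W i0 + 1) i f`_i -> (i <= size f)%N.
  rewrite /above negb_or => /andP[fi _]; rewrite leqNgt.
  by apply: contra fi => szi; rewrite nth_default // ltnW.
exists (W i0), (ex_minn exP), (ex_maxn exP ubP).
case: ex_minnP => l nl l_min; case: ex_maxnP => u nu u_max.
split=> //; rewrite ?/on_line ?ab //.
  by move=> i il; apply/negPn/negP => /l_min; rewrite leqNgt il.
by move=> i ui; apply/negPn/negP => /u_max; rewrite leqNgt ui.
Qed.

Lemma supporting_uniq (f : {poly int}) (m m' : int) (l l' u u' : nat) :
  supporting f m l u -> supporting f m' l' u' -> [/\ m = m', l = l' & u = u'].
Proof.
have le_m m1 m2 l1 l2 u1 u2 :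
    supporting f m1 l1 u1 -> supporting f m2 l2 u2 -> m2 <= m1.
  move=> s1 s2; rewrite leNgt; apply/negP => lt12.
  have /andP[_ /negP[]] := supp_l s1.
  by apply: aboveW (supp_above s2 l1); lia.
move=> s s'; have em : m = m'.
  by apply/le_anti; rewrite (le_m _ _ _ _ _ _ s s') (le_m _ _ _ _ _ _ s' s).
move: s'; rewrite -em => s'.
have on_l m1 l1 u1 l2 : supporting f m1 l1 u1 -> on_line p b c m1 l2 f`_l2 ->
    (l1 <= l2 <= u1)%N.
  move=> s1 /andP[_ nab]; apply/andP; split; rewrite leqNgt.
    by apply: contra nab; apply: (supp_left s1).
  by apply: contra nab; apply: (supp_right s1).
have := on_l _ _ _ _ s (supp_l s'); have := on_l _ _ _ _ s (supp_u s').
have := on_l _ _ _ _ s' (supp_l s); have := on_l _ _ _ _ s' (supp_u s).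
by split=> //; lia.
Qed.

(** * Supporting lines of a product *)

(** Only the pair [(i0, j0)] gives a term on the line; every other term has a factor strictly above
    its own line, so nothing cancels it. *)
Lemma on_line_coefM (g h : {poly int}) (m m' : int) (i0 j0 : nat) :
  (forall i, above p b c m i g`_i) -> (forall i, above p b c m' i h`_i) ->
  on_line p b c m i0 g`_i0 -> on_line p b c m' j0 h`_j0 ->
  (forall i j, (i + j = i0 + j0)%N -> i != i0 ->
    above p b c (m + 1) i g`_i || above p b c (m' + 1) j h`_j) ->
  on_line p b c (m + m') (i0 + j0) (g * h)`_(i0 + j0).
Proof.
move=> abg abh on_g on_h off; rewrite coefM.
have lt0 : (i0 < (i0 + j0).+1)%N by rewrite ltnS leq_addr.
rewrite (bigD1 (Ordinal lt0)) //= addKn.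
apply: on_lineD; first exact: on_lineM.
apply: above_sum => i ne_i.
have ei : (i + (i0 + j0 - i) = i0 + j0)%N by rewrite subnKC // -ltnS.
have /orP[abi|abj] := off i _ ei ne_i.
  by rewrite -{1}ei addrAC; apply: aboveM.
by rewrite -{1}ei -addrA; apply: aboveM.
Qed.

(** An index pair with sum [l + l'] other than [(l, l')] has [i < l] or [j < l'], where the points
    are strictly above; the right end is symmetric. *)
Lemma supportingM (g h : {poly int}) (m m' : int) (l l' u u' : nat) :
  supporting g m l u -> supporting h m' l' u' ->
  supporting (g * h) (m + m') (l + l') (u + u').
Proof.
move=> sg sh; have abg := supp_above sg; have abh := supp_above sh.
split.
- move=> k; rewrite coefM; apply: above_sum => i _.
  have ek : (i + (k - i) = k)%N by rewrite subnKC // -ltnS.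
  by rewrite -{1}ek; apply: aboveM.
- apply: on_line_coefM (supp_l sg) (supp_l sh) _ => // i j eij nei.
  have [/(supp_left sg) -> //|gei] := ltnP i l.
  by rewrite (supp_left sh) ?orbT //; lia.
- apply: on_line_coefM (supp_u sg) (supp_u sh) _ => // i j eij nei.
  have [/(supp_right sg) -> //|gei] := ltnP u i.
  by rewrite (supp_right sh) ?orbT //; lia.
- move=> k ltk; rewrite coefM; apply: above_sum => i _.
  have ek : (i + (k - i) = k)%N by rewrite subnKC // -ltnS.
  rewrite -{1}ek; have [lti|gei] := ltnP i l.
    by rewrite addrAC; apply: aboveM => //; apply: (supp_left sg).
  by rewrite -addrA; apply: aboveM => //; apply: (supp_left sh); lia.
- move=> k ltk; rewrite coefM; apply: above_sum => i _.
  have ek : (i + (k - i) = k)%N by rewrite subnKC // -ltnS.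
  rewrite -{1}ek; have [lti|gei] := ltnP u i.
    by rewrite addrAC; apply: aboveM => //; apply: (supp_right sg).
  by rewrite -addrA; apply: aboveM => //; apply: (supp_right sh); lia.
Qed.

(** * Primitive segments and factorizations *)

Lemma supporting_le (f : {poly int}) (m : int) (l u : nat) :
  supporting f m l u -> (l <= u < size f)%N.
Proof.
move=> s; have /on_lineP[fu _] := supp_u s; apply/andP; split.
  rewrite leqNgt; apply/negP => /(supp_right s) ab.
  by have /andP[_ /negP[]] := supp_l s.
by rewrite ltnNge; apply: contra fu => szu; rewrite nth_default.
Qed.

(** Subtracting the line equations at the two ends shows that [b] divides [c * (u - l)]. *)
Lemma supporting_dvd (f : {poly int}) (m : int) (l u : nat) :
  coprimez b%:Z c -> supporting f m l u -> (b %| u - l)%N.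
Proof.
move=> cop s; have /andP[le_lu _] := supporting_le s.
have /on_lineP[_ el] := supp_l s; have /on_lineP[_ eu] := supp_u s.
suff : (b%:Z %| (u - l)%N%:Z)%Z by rewrite dvdzE.
rewrite -(Gauss_dvdzr _ cop); apply/dvdzP.
exists ((valz p f`_l)%:Z - (valz p f`_u)%:Z).
by rewrite -subzn //; lia.
Qed.

(* Dumas: a primitive segment of the Newton polygon is inherited whole by
   exactly one of the two factors. *)
Lemma supporting_factor (f g h : {poly int}) (m : int) (l : nat) :
  coprimez b%:Z c -> f = g * h -> f != 0 -> supporting f m l (l + b) ->
  exists mg lg ug mh lh uh,
    [/\ supporting g mg lg ug, supporting h mh lh uh, (lg + lh = l)%N,
        (ug + uh = l + b)%N &
        (ug = lg /\ uh = lh + b \/ ug = lg + b /\ uh = lh)%N].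
Proof.
move=> cop ->; rewrite mulf_eq0 negb_or => /andP[g0 h0] s.
have [mg [lg [ug sg]]] := supporting_exists g0.
have [mh [lh [uh sh]]] := supporting_exists h0.
have [_ el eu] := supporting_uniq s (supportingM sg sh).
exists mg, lg, ug, mh, lh, uh; split=> //.
have /andP[leg _] := supporting_le sg; have /andP[leh _] := supporting_le sh.
have /dvdnP[kg ekg] := supporting_dvd cop sg.
have /dvdnP[kh ekh] := supporting_dvd cop sh.
(* The two widths are multiples of [b] with sum [b]; for positive [b] exactly one of them is
   zero. *)
have esum : ((kg + kh) * b = b)%N by lia.
have [b0|b_gt0] := posnP b; first by left; lia.
have : (kg + kh = 1)%N by apply/eqP; rewrite -(eqn_pmul2r b_gt0) mul1n; apply/eqP.
by case: kg ekg esum => [|[|kg]] ekg _ ?; [left|right|]; lia.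
Qed.

End Line.

(** * Order of the segments *)

(* Lines of smaller slope touch the Newton polygon further to the right. *)
Lemma supporting_slopes (p b1 b2 : nat) (c1 c2 : int) (f : {poly int})
    (m1 m2 : int) (l1 u1 l2 u2 : nat) :
  (0 < b1)%N -> (0 < b2)%N -> c2 * b1%:Z < c1 * b2%:Z ->
  supporting p b1 c1 f m1 l1 u1 -> supporting p b2 c2 f m2 l2 u2 ->
  (u1 <= l2)%N.
Proof.
move=> b1_gt0 b2_gt0 lt_c s1 s2; rewrite leqNgt; apply/negP => lt_lu.
have /on_lineP[fu eu] := supp_u s1; have /on_lineP[fl el] := supp_l s2.
(* The slopes are [- c1 / b1 < - c2 / b2]. Each touching point lies above the other line, so with
   [d = u1 - l2 > 0] one gets [c1 d <= b1 (vl - vu)] and [b2 (vl - vu) <= c2 d], against [lt_c]. *)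
have := supp_above s1 l2; rewrite /above (negPf fl) /= => le1.
have := supp_above s2 u1; rewrite /above (negPf fu) /= => le2.
move: (valz p f`_u1)%:Z (valz p f`_l2)%:Z eu el le1 le2 => vu vl eu el le1 le2.
have {le1 eu} : c1 * (u1%:Z - l2%:Z) <= b1%:Z * (vl - vu) by lia.
have {le2 el} : b2%:Z * (vl - vu) <= c2 * (u1%:Z - l2%:Z) by lia.
have : 0 < u1%:Z - l2%:Z :> int by lia.
move: (u1%:Z - l2%:Z : int) (vl - vu) => d v d_gt0 le2 le1.
have b1Z : 0 < b1%:Z :> int by lia.
have b2Z : 0 < b2%:Z :> int by lia.
have := ler_wpM2l (ltW b2Z) le1; have := ler_wpM2l (ltW b1Z) le2.
have := ltr_pM2r d_gt0 (c2 * b1%:Z) (c1 * b2%:Z); rewrite lt_c.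
by lia.
Qed.

(** * From extended rationals to natural numbers *)

Lemma nu_neq0 (p : nat) (x : int) : x != 0 -> nu p x = (valz p x)%:R%:E.
Proof. by rewrite /nu => /negPf ->. Qed.

Lemma nu0 (p : nat) : nu p 0 = +oo%E.
Proof. by rewrite /nu eqxx. Qed.

Lemma nu_fin_neq0 (p : nat) (x : int) : (nu p x < +oo)%E -> x != 0.
Proof. by apply: contraTneq => ->; rewrite nu0 ltxx. Qed.

Lemma nu_lt_div (p a b : nat) (x y : int) : (0 < a)%N -> (0 < b)%N ->
  x != 0 -> y != 0 -> (nu p y / b%:R%:E < nu p x / a%:R%:E)%E ->
  (valz p y * a < valz p x * b)%N.
Proof.
move=> a_gt0 b_gt0 x0 y0; rewrite !nu_neq0 // !inver !pnatr_eq0 !gtn_eqF //.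
by rewrite -!EFinM lte_fin ltr_pdivrMr ?ltr0n // mulrAC ltr_pdivlMr ?ltr0n //
  -!natrM ltr_nat.
Qed.

(** * Criterion for a supporting line, and chord inequalities *)

(** Meant for segments carrying no coefficient point strictly between their ends. *)
Lemma supporting_intro (p b : nat) (c m : int) (f : {poly int}) (l u : nat) :
  (l <= u)%N -> on_line p b c m l f`_l -> on_line p b c m u f`_u ->
  (forall i, i != l -> i != u -> f`_i != 0 ->
    m < c * i%:Z + b%:Z * (valz p f`_i)%:Z) ->
  supporting p b c f m l u.
Proof.
move=> le_lu on_l on_u off.
have ab i : i != l -> i != u -> above p b c (m + 1) i f`_i.
  move=> nil niu; rewrite /above; have [//|fi /=] := eqVneq f`_i 0.
  by rewrite lezD1; apply: off.
split=> // i.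
- have [->|nil] := eqVneq i l; first by case/andP: on_l.
  have [->|niu] := eqVneq i u; first by case/andP: on_u.
  by apply: aboveW (ab i nil niu); lia.
- by move=> lti; apply: ab; lia.
- by move=> lti; apply: ab; lia.
Qed.

Lemma coef_neq0_le (f : {poly int}) (n i : nat) :
  size f = n.+1 -> f`_i != 0 -> (i <= n)%N.
Proof.
by move=> sz fi; rewrite -ltnS -sz ltnNge; apply: contra fi => ?; rewrite nth_default.
Qed.

Lemma chord_before (v j i : nat) : (0 < v)%N -> (i < j)%N ->
  - v%:Z * j%:Z < - v%:Z * i%:Z.
Proof. by move=> v_gt0 lt_ij; nia. Qed.

(** The line is [- v X + (n - j) Y = - v j], through [(j, 0)] and [(n, v)]. *)
Lemma chord_from_0 (v w n j i : nat) : (j < i)%N ->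
  (v * (i - j) < w * (n - j))%N ->
  - v%:Z * j%:Z < - v%:Z * i%:Z + (n - j)%N%:Z * w%:Z.
Proof.
by move=> lt_ji; rewrite mulnBr; move: (n - j)%N => b; lia.
Qed.

(** The line is [v X + (n - j) Y = v n], through [(j, v)] and [(n, 0)]. *)
Lemma chord_to_0 (v w n j i : nat) : (i <= n)%N ->
  (v * (n - i) < w * (n - j))%N ->
  v%:Z * n%:Z < v%:Z * i%:Z + (n - j)%N%:Z * w%:Z.
Proof. by move=> le_in; rewrite mulnBr; move: (n - j)%N => b; nia. Qed.

(** The line is [(v0 - vj) X + j Y = j v0], through [(0, v0)] and [(j, vj)]. *)
Lemma chord1 (v0 vj w j i : nat) : (i <= j)%N ->
  ((j - i) * v0 + i * vj < j * w)%N ->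
  j%:Z * v0%:Z < (v0%:Z - vj%:Z) * i%:Z + j%:Z * w%:Z.
Proof. by move=> le_in; rewrite mulnBl; nia. Qed.

(* Here and in [chord2_before] the convexity of the polygon at [j] is used: a
   point above one of its two sides is strictly above the extension of the other. *)
Lemma chord1_after (v0 vj w n j i : nat) : (j < i <= n)%N ->
  (vj * n < v0 * (n - j))%N -> (vj * (n - i) <= w * (n - j))%N ->
  j%:Z * v0%:Z < (v0%:Z - vj%:Z) * i%:Z + j%:Z * w%:Z.
Proof.
move=> /andP[lt_ji le_in].
have [e [r [e_gt0 -> ->]]] : exists e r, [/\ 0 < e, i = j + e & n = j + e + r]%N.
  by exists (i - j)%N, (n - i)%N; split; lia.
rewrite addKn -addnA addKn addnA => lt1 le2.
(* Convexity is weighted by [e = i - j] and the side inequality by [j]; their sum has the common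
   factor [e + r = n - j]. *)
have : (e * (vj * (j + e + r)) < e * (v0 * (e + r)))%N.
  by rewrite ltn_pmul2l // -addnA.
have := leq_mul (leqnn j) le2.
suff : ((e + r) * (j * v0 + vj * (j + e)) < (e + r) * (v0 * (j + e) + j * w))%N.
  by rewrite ltn_pmul2l ?addn_gt0 ?e_gt0 //; nia.
by nia.
Qed.

Lemma chord2_before (v0 vj w n j i : nat) : (i < j)%N -> (j < n)%N ->
  (vj * n < v0 * (n - j))%N -> ((j - i) * v0 + i * vj <= j * w)%N ->
  vj%:Z * n%:Z < vj%:Z * i%:Z + (n - j)%N%:Z * w%:Z.
Proof.
move=> lt_ij lt_jn.
have [e [k [e_gt0 -> ->]]] : exists e k, [/\ 0 < e, j = i + e & n = i + e + k]%N.
  by exists (j - i)%N, (n - j)%N; split; lia.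
rewrite !addKn => lt1 le2.
have : (e * (vj * (i + e + k)) < e * (v0 * k))%N by rewrite ltn_pmul2l.
have := leq_mul (leqnn k) le2.
suff : ((i + e) * (vj * (i + e + k)) < (i + e) * (vj * i + k * w))%N.
  by rewrite ltn_pmul2l ?addn_gt0 ?e_gt0 ?orbT //; nia.
by nia.
Qed.

(** * Irreducibility *)

Theorem theorem1p41 (n : nat) (f : {poly int}) (p q j1 j2 : nat)
  (size_f : size f = n.+1)
  (f0n_neq0 : f`_0 * f`_n != 0)
  (p_prime : prime p) (q_prime : prime q) (neq_pq : p != q)
  (le_j1n : (j1 <= n)%N) (le_j2n : (j2 <= n)%N) (neq_j : j1 != j2)
  (lt_j1 : (j1 < minn j2 (n - j2))%N)
  (p_low : forall i : nat, (i <= j1)%N -> nu p f`_i = 0%E)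
  (p_mid : forall i : nat, (j1 < i < n)%N ->
     (nu p f`_i / (i - j1)%N%:R%:E > nu p f`_n / (n - j1)%N%:R%:E)%E)
  (p_top : (nu p f`_n > 0)%E)
  (q_slopes : (nu q f`_0 / n%:R%:E > nu q f`_j2 / (n - j2)%N%:R%:E)%E)
  (q_low : forall i : nat, (0 < i < j2)%N ->
     (nu q f`_i > ((j2 - i)%N%:R / j2%:R)%:E * nu q f`_0
                  + (i%:R / j2%:R)%:E * nu q f`_j2)%E)
  (q_j2 : (nu q f`_j2 > 0)%E)
  (q_high : forall i : nat, (j2 < i < n)%N ->
     (nu q f`_i / (n - i)%N%:R%:E > nu q f`_j2 / (n - j2)%N%:R%:E)%E)
  (q_top : nu q f`_n = 0%E)
  (* Here f`_0, f`_j2 and f`_n are nonzero, so valz is the valuation *)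
  (gcd_p : gcdn (valz p f`_n) (n - j1) = 1%N)
  (gcd_q_low : gcdz ((valz q f`_0)%:Z - (valz q f`_j2)%:Z) j2%:Z = 1)
  (gcd_q_high : gcdn (valz q f`_j2) (n - j2) = 1%N) :
  irreducible_poly (map_poly (intr : int -> rat) f).

Proof.
have [f0_neq0 fn_neq0] : f`_0 != 0 /\ f`_n != 0.
  by apply/andP; rewrite -negb_or -mulf_eq0.
have j2_gt0 : (0 < j2)%N by lia.
have nj2_gt0 : (0 < n - j2)%N by lia.
have nj1_gt0 : (0 < n - j1)%N by lia.
have n_gt0 : (0 < n)%N by lia.
have fj2_neq0 : f`_j2 != 0.
  (* A zero coefficient would make the smaller side of [q_slopes] infinite. *)
  apply: contraTneq q_slopes => ->; rewrite nu0 inver pnatr_eq0 gtn_eqF //.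
  by rewrite mulyr gtr0_sg ?invr_gt0 ?ltr0n // mul1e -leNgt leey.
have vp_low i : (i <= j1)%N -> f`_i != 0 /\ valz p f`_i = 0%N.
  move=> le_i; have nui := p_low _ le_i.
  have fi : f`_i != 0 by apply: (@nu_fin_neq0 p); rewrite nui ltey.
  by split=> //; move: nui; rewrite nu_neq0 // => -[] /eqP; rewrite pnatr_eq0 => /eqP.
have vp_mid i : (j1 < i < n)%N -> f`_i != 0 ->
    (valz p f`_n * (i - j1) < valz p f`_i * (n - j1))%N.
  by move=> lti fi; apply: nu_lt_div (p_mid i lti); rewrite ?subn_gt0; lia.
have vp_top : (0 < valz p f`_n)%N by move: p_top; rewrite nu_neq0 // lte_fin ltr0n.
have vq_slopes : (valz q f`_j2 * n < valz q f`_0 * (n - j2))%N.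
  exact: nu_lt_div q_slopes.
have vq_low i : (0 < i < j2)%N -> f`_i != 0 ->
    ((j2 - i) * valz q f`_0 + i * valz q f`_j2 < j2 * valz q f`_i)%N.
  move=> lti fi; have := q_low _ lti; rewrite !nu_neq0 // -!EFinM -EFinD lte_fin.
  by rewrite -![_ / _ * _]mulrAC -mulrDl ltr_pdivrMr ?ltr0n // -!natrM -natrD
    ltr_nat [(valz _ _ * _)%N]mulnC.
have vq_j2 : (0 < valz q f`_j2)%N by move: q_j2; rewrite nu_neq0 // lte_fin ltr0n.
have vq_high i : (j2 < i < n)%N -> f`_i != 0 ->
    (valz q f`_j2 * (n - i) < valz q f`_i * (n - j2))%N.
  by move=> lti fi; apply: nu_lt_div (q_high i lti); rewrite ?subn_gt0; lia.
have vq_top : valz q f`_n = 0%N.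
  by move: q_top; rewrite nu_neq0 // => -[] /eqP; rewrite pnatr_eq0 => /eqP.
(* The right end is written [j1 + (n - j1)] to display the width that [supporting_factor]
   expects. *)
have p_seg : supporting p (n - j1) (- (valz p f`_n)%:Z) f
    (- (valz p f`_n)%:Z * j1%:Z) j1 (j1 + (n - j1)).
  rewrite subnKC //; have [fj1 vj1] := vp_low _ (leqnn j1).
  apply: supporting_intro => //.
  - by apply: above_on_line => //; rewrite vj1; lia.
  - by apply: above_on_line => //; rewrite -subzn //; lia.
  move=> i ni1 nin fi; have le_in := coef_neq0_le size_f fi.
  have [le_i|lti] := leqP i j1.
    by have [_ ->] := vp_low i le_i; rewrite mulr0 addr0 chord_before // ltn_neqAle ni1.
  by apply: chord_from_0 => //; apply: vp_mid => //; rewrite lti ltn_neqAle nin.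
have q_seg1 : supporting q j2 ((valz q f`_0)%:Z - (valz q f`_j2)%:Z) f
    (j2%:Z * (valz q f`_0)%:Z) 0 (0 + j2).
  rewrite add0n; apply: supporting_intro => //.
  - by apply: above_on_line => //; lia.
  - by apply: above_on_line => //; lia.
  move=> i ni0 nij2 fi; have le_in := coef_neq0_le size_f fi.
  have [lti|gti] := ltnP i j2; first by apply/chord1/vq_low; lia.
  (* At [n] there is only equality, since that point lies on the second side. *)
  have le_vi : (valz q f`_j2 * (n - i) <= valz q f`_i * (n - j2))%N.
    by have [->|nin] := eqVneq i n; [lia | apply/ltnW/vq_high => //; lia].
  by apply: (@chord1_after _ _ _ n) => //; lia.
have q_seg2 : supporting q (n - j2) (valz q f`_j2)%:Z f
    ((valz q f`_j2)%:Z * n%:Z) j2 (j2 + (n - j2)).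
  rewrite subnKC //; apply: supporting_intro => //.
  - by apply: above_on_line => //; rewrite -subzn //; lia.
  - by apply: above_on_line => //; lia.
  move=> i nij2 nin fi; have le_in := coef_neq0_le size_f fi.
  have [lti|gti] := ltnP i j2; last by apply/chord_to_0/vq_high; lia.
  (* Likewise the point at [0] lies on the first side. *)
  have le_vi : ((j2 - i) * valz q f`_0 + i * valz q f`_j2 <= j2 * valz q f`_i)%N.
    by have [->|ni0] := eqVneq i 0%N; [lia | apply/ltnW/vq_low => //; lia].
  by apply: chord2_before le_vi => //; lia.
have cop_p : coprimez (n - j1)%N%:Z (- (valz p f`_n)%:Z).
  by rewrite coprimezN /coprimez /gcdz /= gcdnC gcd_p.
have cop_q1 : coprimez j2%:Z ((valz q f`_0)%:Z - (valz q f`_j2)%:Z).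
  by rewrite /coprimez gcdzC gcd_q_low.
have cop_q2 : coprimez (n - j2)%N%:Z (valz q f`_j2)%:Z.
  by rewrite /coprimez /gcdz /= gcdnC gcd_q_high.
have f_neq0 : f != 0 by rewrite -size_poly_gt0 size_f.
split; first by rewrite size_rat_int_poly size_f.
(* By Gauss's lemma the rational divisor [d] is a scalar multiple of an integer factor [g] of [f];
   it remains to show that [g] has full size. *)
move=> d size_d d_dvd; have [g [a a0 def_d] [h def_f]] := dvdpP_rat_int d_dvd.
rewrite -dvdp_size_eqp //; apply/eqP.
have size_dg : size d = size g by rewrite def_d size_scale // size_rat_int_poly.
rewrite size_dg in size_d *; rewrite size_rat_int_poly.
have [g0 h0] : g != 0 /\ h != 0.
  by apply/andP; rewrite -negb_or -mulf_eq0 -def_f.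
have size_gh : (size g + size h = n.+2)%N.
  have := size_mul g0 h0; rewrite -def_f size_f.
  have : (0 < size g)%N by rewrite size_poly_gt0.
  by case: (size g) => // k _ /= ->.
have [mg [lg [ug [mh [lh [uh [sg sh el eu w]]]]]]] :=
  supporting_factor p_prime cop_p def_f f_neq0 p_seg.
have [mg1 [lg1 [ug1 [mh1 [lh1 [uh1 [sg1 sh1 el1 eu1 w1]]]]]]] :=
  supporting_factor q_prime cop_q1 def_f f_neq0 q_seg1.
have [mg2 [lg2 [ug2 [mh2 [lh2 [uh2 [sg2 sh2 el2 eu2 w2]]]]]]] :=
  supporting_factor q_prime cop_q2 def_f f_neq0 q_seg2.
(* Convexity at [j2] orders the two segments inside each factor as well. *)
have slope_lt : (valz q f`_j2)%:Z * j2%:Z <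
    ((valz q f`_0)%:Z - (valz q f`_j2)%:Z) * (n - j2)%N%:Z.
  rewrite mulrBl ltrBrDr -mulrDr -!PoszD -!PoszM ltz_nat.
  by rewrite subnKC.
have le_g := supporting_slopes j2_gt0 nj2_gt0 slope_lt sg1 sg2.
have le_h := supporting_slopes j2_gt0 nj2_gt0 slope_lt sh1 sh2.
(* The upper ends at [p] add up to [n], the sum of the degrees, so each is the degree of its factor;
   the same holds for the second line at [q]. *)
move: (supporting_le sg) (supporting_le sh) (supporting_le sg1)
  (supporting_le sh1) (supporting_le sg2) (supporting_le sh2).
rewrite size_f.
clear - size_d size_gh el eu w el1 eu1 w1 el2 eu2 w2 le_g le_h lt_j1.
move: (size g) (size h) size_d size_gh => dg dh size_d size_gh.
(* At [q], [ug1 = lg2] and [uh1 = lh2], so [g] has degree [0], [j2], [n - j2] or [n]. At [p], one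
   factor has degree at most [j1], which excludes the two middle values; [size_d] excludes [0]. *)
lia.
Qed.
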